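(* For integers $n,r,s\ge 0$ put $$S_5(n,r,s)=\sum_{k=0}^{n} \binom{2n-2k+s}{n-k} \, \binom{2k+r}{k}.$$ Let $e,d_1,d_2,d_3$ be positive integers and set $$n=e+1-(d_1+d_2+d_3),$$ $$r_1=d_1-2,\quad s_1=d_2+d_3-2,\qquad r_2=d_1+d_2+d_3-6,\quad s_2=2,$$ $$r_3=d_1+d_2-4,\quad s_3=d_3,\qquad r_4=d_1+d_3-4,\quad s_4=d_2,$$ and assume that $n$ and all $r_i,s_i$ ($1\le i\le 4$) are non-negative. Then $$S_5(n,r_3,s_3)+S_5(n,r_4,s_4)-S_5(n,r_1,s_1)-S_5(n,r_2,s_2)=0 .$$ *)

(* Defs.v *)
From mathcomp Require Import all_boot all_order all_algebra.
Set Implicit Arguments.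
Unset Strict Implicit.
Unset Printing Implicit Defensive.

(* The natural-number subtractions are exact: k <= n over the whole range. *)
Definition S5 (n r s : nat) : nat :=
  (\sum_(0 <= k < n.+1) 'C(2 * n - 2 * k + s, n - k) * 'C(2 * k + r, k))%N.

(* Main.v *)
Require Import Defs.
From mathcomp Require Import all_boot all_order all_algebra.
From mathcomp Require Import zify.

(** The four pairs [(r, s)] in the theorem have the same sum
    [d1 + d2 + d3 - 4], and [S5 n r s] depends on [r] and [s] only through
    [r + s]; so the alternating sum of the four values vanishes.

    With [B] the generating function of the Catalan numbers, the series
    [\sum_k 'C(2 * k + r, k) x^k] is [B^r / sqrt (1 - 4 x)], so that [S5 n r s]
    is the coefficient of [x^n] in [B^(r + s) / (1 - 4 x)]. The functional
    equation [B = 1 + x B^2] is, on coefficients, Pascal's rule, and it can be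
    applied to either factor: raising [r] by one adds [S5 (n - 1) (r + 2) s]
    ([S5_Sr]), raising [s] by one adds [S5 (n - 1) r (s + 2)] ([S5_Ss]). By
    induction on [n] both increments are equal, hence a unit can be moved from
    [s] to [r] ([S5_shift]). *)

Set Implicit Arguments.
Unset Strict Implicit.
Unset Printing Implicit Defensive.
Import GRing.Theory Num.Theory.
Local Open Scope ring_scope.

(** Reversing the order of summation exchanges the two factors. *)
Lemma S5C (n r s : nat) : S5 n r s = S5 n s r.
Proof.
rewrite /S5 big_nat_rev /=; apply: eq_big_nat => k /andP[_ lt_k_Sn].
rewrite add0n subSS subKn // mulnC.
by congr ('C(_, _) * 'C(_, _))%N; lia.
Qed.

(** Pascal's rule in each term with [k > 0] of the sum; the index of the
    second binomial coefficient it produces is shifted by one, so these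
    coefficients form a sum of the same shape for [n]. *)
Lemma S5_Sr (n r s : nat) :
  S5 n.+1 r.+1 s = (S5 n.+1 r s + S5 n r.+2 s)%N.
Proof.
rewrite /S5 big_nat_recl // [in RHS]big_nat_recl // -addnA -big_split /=.
congr addn; first by rewrite !bin0.
apply: eq_bigr => k _; rewrite addnS binS mulnDr subSS.
by congr (_ * _ + 'C(_, _) * 'C(_, _))%N; lia.
Qed.

Lemma S5_Ss (n r s : nat) :
  S5 n.+1 r s.+1 = (S5 n.+1 r s + S5 n r s.+2)%N.
Proof. by rewrite S5C S5_Sr S5C (S5C n). Qed.

(** Once both sides are expanded for [n.+1], they differ only in
    [S5 n r s.+2] and [S5 n r.+2 s], so two units must be moved for [n]: hence
    an induction in which [r] and [s] vary. *)
Lemma S5_shift (n r s : nat) : S5 n r s.+1 = S5 n r.+1 s.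
Proof.
elim: n r s => [|n IHn] r s; first by rewrite /S5 !big_nat1 !bin0.
by rewrite S5_Sr S5_Ss !IHn.
Qed.

Lemma S5_addn (n r s : nat) : S5 n r s = S5 n (r + s) 0.
Proof. by elim: s r => [|s IHs] r; rewrite ?addn0 // S5_shift IHs addSnnS. Qed.

Theorem proposition3 (e d1 d2 d3 : nat)
  (n r1 s1 r2 s2 r3 s3 r4 s4 : nat)
  (he : (0 < e)%N) (hd1 : (0 < d1)%N) (hd2 : (0 < d2)%N) (hd3 : (0 < d3)%N)
  (hn : n%:Z = e%:Z + 1 - (d1%:Z + d2%:Z + d3%:Z))
  (hr1 : r1%:Z = d1%:Z - 2) (hs1 : s1%:Z = d2%:Z + d3%:Z - 2)
  (hr2 : r2%:Z = d1%:Z + d2%:Z + d3%:Z - 6) (hs2 : s2%:Z = 2)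
  (hr3 : r3%:Z = d1%:Z + d2%:Z - 4) (hs3 : s3%:Z = d3%:Z)
  (hr4 : r4%:Z = d1%:Z + d3%:Z - 4) (hs4 : s4%:Z = d2%:Z) :
  (S5 n r3 s3)%:Z + (S5 n r4 s4)%:Z - (S5 n r1 s1)%:Z - (S5 n r2 s2)%:Z = 0.
Proof.
rewrite !(S5_addn n _ s1) !(S5_addn n _ s2) !(S5_addn n _ s3) !(S5_addn n _ s4).
have -> : (r4 + s4 = r1 + s1)%N by lia.
have -> : (r3 + s3 = r1 + s1)%N by lia.
have -> : (r2 + s2 = r1 + s1)%N by lia.
by rewrite addrK subrr.
Qed.
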